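(* Let $\Gamma = \mathrm{SL}_3(\mathbf{Z})$ and let $\sqsubset$ be the left-invariant partial order on $\Gamma$ defined by $x \sqsubset y \iff x^{-1}y \in S$, where $S$ is the semigroup generated by the six standard unipotent matrices $a_1,\dots,a_6$. Then $\mathrm{Ext}(\sqsubset) \in \mathscr{W}$, where $\mathscr{W}$ is the collection of countable unions of wandering sets for the action of $\Gamma$ on $\mathrm{Ord}(\Gamma)$. In particular, there is no invariant random total order on $\Gamma$ extending $\sqsubset$, i.e. there is no $\Gamma$-invariant Borel probability measure $\mu$ on $\mathrm{Ord}(\Gamma)$ with $\mu(\mathrm{Ext}(\sqsubset)) = 1$.
   Context: Let $E_{ij}$ ($i \ne j$) denote the $3\times 3$ matrix with $1$'s on the diagonal, $1$ in position $(i,j)$ and $0$ elsewhere. Then $a_1 = E_{12}$, $a_2 = E_{13}$, $a_3=E_{23}$, $a_4 = E_{21}$, $a_5 = E_{31}$, $a_6 = E_{32}$; $S$ is the set of all finite nonempty products of these matrices (it does not contain the identity). $\mathrm{Ord}(\Gamma)$ is the set of (strict) total orders on the set $\Gamma$ (irreflexive, transitive, any two distinct elements comparable in exactly one way), a compact metrizable space as a closed subset of $\{0,1\}^{\Gamma\times\Gamma}$. $\Gamma$ acts on $\mathrm{Ord}(\Gamma)$ by $x\,(\gamma\cdot\prec)\,y \iff \gamma^{-1}x \prec \gamma^{-1}y$. $\mathrm{Ext}(\sqsubset) = \{\prec \in \mathrm{Ord}(\Gamma) : x \sqsubset y \Rightarrow x \prec y \text{ for all } x,y\in\Gamma\}$,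 a closed $\Gamma$-invariant set. For an action of a countable group $\Gamma$ on a Borel space $X$ by Borel automorphisms, a Borel set $A \subseteq X$ is wandering if there is $g\in\Gamma$ such that the sets $(g^nA)_{n\in\mathbf{Z}}$ are pairwise disjoint. *)

(* Defs.v *)
From HB Require Import structures.
From mathcomp Require Import all_boot all_order all_algebra.
From mathcomp Require Import zify.
From mathcomp Require Import all_classical all_reals all_analysis.
Set Implicit Arguments.
Unset Strict Implicit.
Unset Printing Implicit Defensive.
Import GRing.Theory.
Local Open Scope classical_set_scope.
Local Open Scope ring_scope.

Section total_orders.
Variable T : countType.

Definition is_total_order : set {ptws T * T -> bool} :=
  [set r | [/\ forall x, ~~ r (x, x),
               forall x y z, r (x, y) -> r (y, z) -> r (x, z) &
               forall x y, x != y -> r (x, y) (+) r (y, x)]].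

(* A subset of {0,1}^(T x T): it carries the subspace topology of the product
   topology, and the corresponding Borel sigma-algebra. *)
Definition Ord : Type := set_type is_total_order.

HB.instance Definition _ := Topological.on Ord.

Definition ord_rel (o : Ord) : {ptws T * T -> bool} := set_val o.

(* A [measurableType] must be inhabited; countability of T provides an element. *)
Fact pickle_total_order :
  is_total_order (fun p => (pickle p.1 < pickle p.2)%N).
Proof.
split => [x|x y z /=|x y /=]; first by rewrite ltnn.
  exact: ltn_trans.
rewrite -(inj_eq (pcan_inj (@pickleK T))).
by case: ltngtP.
Qed.

HB.instance Definition _ :=
  isPointed.Build Ord (SigSub (mem_set pickle_total_order)).

HB.instance Definition _ := Measurable.copy Ord
  (g_sigma_algebraType (open : set (set Ord))).

Definition Ext (r : T -> T -> Prop) : set Ord :=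
  [set o | forall x y, r x y -> ord_rel o (x, y)].

End total_orders.

(* Integer powers g^n, [Negz m] being -(m + 1). *)
Definition expgz (G : groupType) (g : G) (n : int) : G :=
  match n with
  | Posz m => (g ^+ m)%g
  | Negz m => (g ^- m.+1)%g
  end.

Record borel_action (G : groupType) d (X : measurableType d) := BorelAction {
  bact :> G -> X -> X ;
  bact1 : forall x, bact 1%g x = x ;
  bactM : forall g h x, bact (g * h)%g x = bact g (bact h x) ;
  measurable_bact : forall g, measurable_fun setT (bact g) }.

Section wandering.
Context (G : groupType) d (X : measurableType d) (act : borel_action G X).

Definition wandering (A : set X) : Prop :=
  measurable A /\
  exists g : G, trivIset setT (fun n : int => act (expgz g n) @` A).

Definition sigma_wandering : set (set X) :=
  [set A | exists F : nat -> set X,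
    (forall n, wandering (F n)) /\ A = \bigcup_n F n].

Definition invariant_measure (R : realType) (mu : set X -> \bar R) : Prop :=
  forall (g : G) (A : set X), measurable A -> mu (act g @^-1` A) = mu A.

End wandering.

Definition SL3Z := {A : 'M[int]_3 | \det A == 1}.

HB.instance Definition _ := Countable.on SL3Z.

Section SL3Z_group.
Implicit Types A B : SL3Z.

Fact SL3Z_one_subproof : \det (1%:M : 'M[int]_3) == 1.
Proof. by rewrite det1. Qed.

Fact SL3Z_mul_subproof A B : \det (val A *m val B) == 1.
Proof. by rewrite det_mulmx (eqP (valP A)) (eqP (valP B)) mulr1. Qed.

Fact SL3Z_inv_subproof A : \det (invmx (val A)) == 1.
Proof. by rewrite det_inv (eqP (valP A)) invr1. Qed.

Fact SL3Z_unitmx A : val A \in unitmx.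
Proof. by rewrite unitmxE (eqP (valP A)) unitr1. Qed.

Definition SL3Z_one : SL3Z := Sub 1%:M SL3Z_one_subproof.
Definition SL3Z_mul A B : SL3Z := Sub (val A *m val B) (SL3Z_mul_subproof A B).
Definition SL3Z_inv A : SL3Z := Sub (invmx (val A)) (SL3Z_inv_subproof A).

Fact SL3Z_mulA : associative SL3Z_mul.
Proof. by move=> A B C; apply: val_inj; rewrite /= mulmxA. Qed.

Fact SL3Z_mul1 : left_id SL3Z_one SL3Z_mul.
Proof. by move=> A; apply: val_inj; rewrite /= mul1mx. Qed.

Fact SL3Z_mulr1 : right_id SL3Z_one SL3Z_mul.
Proof. by move=> A; apply: val_inj; rewrite /= mulmx1. Qed.

Fact SL3Z_mulV : left_inverse SL3Z_one SL3Z_inv SL3Z_mul.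
Proof. by move=> A; apply: val_inj; rewrite /= mulVmx ?SL3Z_unitmx. Qed.

Fact SL3Z_mulrV : right_inverse SL3Z_one SL3Z_inv SL3Z_mul.
Proof. by move=> A; apply: val_inj; rewrite /= mulmxV ?SL3Z_unitmx. Qed.

HB.instance Definition _ := isGroup.Build SL3Z
  SL3Z_mulA SL3Z_mul1 SL3Z_mulr1 SL3Z_mulV SL3Z_mulrV.

End SL3Z_group.

Fact det_elementary (i j : 'I_3) :
  i != j -> \det (1%:M + delta_mx i j : 'M[int]_3) == 1.
Proof.
wlog lt_ij : i j / (j < i)%N => [hw|] ij.
  have [ltji|ltij|/val_inj eij] := ltngtP j i; first exact: hw.
    have := hw _ _ ltij; rewrite eq_sym => /(_ ij).
    by rewrite -det_tr linearD /= trmx1 trmx_delta.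
  by rewrite eij eqxx in ij.
rewrite det_trig; last first.
  apply/is_trig_mxP => k l lt_kl; rewrite !mxE -!val_eqE /=.
  rewrite ltn_eqF //=.
  by case: eqP => //= ki; case: eqP => //= lj; move: lt_kl lt_ij; lia.
rewrite big1 // => k _; rewrite !mxE eqxx.
by case: (eqVneq k i) => //= ->; rewrite (negbTE ij) addr0.
Qed.

Definition elementary (i j : 'I_3) (ij : i != j) : SL3Z :=
  Sub (1%:M + delta_mx i j) (det_elementary ij).

(* In 'I_3 indices start at 0, so that E_12 is [elementary 0 1], etc. *)
Definition unipotents : seq SL3Z :=
  [:: @elementary 0 1 isT; @elementary 0 2 isT; @elementary 1 2 isT;
      @elementary 1 0 isT; @elementary 2 0 isT; @elementary 2 1 isT].

Definition unipotent_semigroup : set SL3Z :=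
  [set x | exists s : seq SL3Z,
    [/\ s != [::], {subset s <= unipotents} & x = (\prod_(a <- s) a)%g]].

Definition sqlt (x y : SL3Z) : Prop := unipotent_semigroup (x^-1 * y)%g.

Section shift.
Implicit Types (g : SL3Z) (o : Ord SL3Z).

Definition shift_rel g (r : {ptws SL3Z * SL3Z -> bool}) :
    {ptws SL3Z * SL3Z -> bool} :=
  fun p => r (g^-1 * p.1, g^-1 * p.2)%g.

Fact shift_subproof g o : is_total_order (shift_rel g (ord_rel o)).
Proof.
have [irr tr tot] := set_valP o; split => [x|x y z|x y xy].
- exact: irr.
- exact: tr.
- by apply: tot; rewrite (inj_eq (mulgI _)).
Qed.

Definition shift g o : Ord SL3Z := SigSub (mem_set (shift_subproof g o)).

Fact shift1 o : shift 1%g o = o.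
Proof.
apply: val_inj => /=; apply: funext => -[x y].
by rewrite /shift_rel /= invg1 !mul1g.
Qed.

Fact shiftM g h o : shift (g * h)%g o = shift g (shift h o).
Proof.
apply: val_inj => /=; apply: funext => -[x y].
by rewrite /shift_rel /ord_rel /= /shift_rel /= invgM -!mulgA.
Qed.

Fact shift_continuous g : continuous (shift g).
Proof.
have ev_cont p : continuous (fun o => ord_rel o p).
  move=> o; apply: (@continuous_comp _ _ _
    (@ord_rel SL3Z) (@proj _ (fun=> bool) p)).
    exact: initial_continuous.
  exact: proj_continuous.
apply: continuous_comp_initial => o.
have FF : Filter ((@ord_rel SL3Z \o shift g) x @[x --> o]).
  exact/fmap_filter/nbhs_filter.
apply: (iffRL (@cvg_sup _ _ _ _ _ FF)) => p.
suff : continuous ((@ord_rel SL3Z \o shift g) :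
    Ord SL3Z -> initial_topology (fun f : SL3Z * SL3Z -> bool => f p)).
  exact.
by apply: continuous_comp_initial; exact: ev_cont.
Qed.

Fact measurable_shift g : measurable_fun setT (shift g).
Proof.
apply: (measurability (open : set (set (Ord SL3Z)))) => // _ [U oU <-].
rewrite setTI.
apply: sub_sigma_algebra; move/continuousP: (@shift_continuous g); exact.
Qed.

Definition shift_action : borel_action SL3Z (Ord SL3Z) :=
  BorelAction shift1 shiftM measurable_shift.

End shift.

(* Main.v *)
Require Import Defs.
From mathcomp Require Import all_boot all_order all_algebra.
From mathcomp Require Import zify.
From mathcomp Require Import all_classical all_reals all_analysis.

Set Implicit Arguments.
Unset Strict Implicit.
Unset Printing Implicit Defensive.
Import Order.TTheory GRing.Theory Num.Theory.

Local Open Scope classical_set_scope.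

(** Why the theorem holds.  By Poincare's argument, the points of a Borel set [A]
    which never return to [A] under the positive powers of a group element form a
    wandering set ([wandering_nonreturning]).  Apply this to the events
    saying that a whole ray (y s^n), n >= 0, lies below a point w: there are
    countably many of them and countably many group elements, so it is enough to
    show that no order extending the semigroup order is recurrent for all these
    events at once.  That is a deterministic statement about one order, in which
    right multiplication by any of the six unipotents moves every element up.

    Fix such a recurrent order.  At an element x, compare the rays (x u^n), for u
    one of the unipotents, by the down-sets which they generate; this is a total
    preorder, called dominance.  In the cyclic order E12, E13, E23, E21, E31, E32
    each unipotent z is central in a Heisenberg group generated by its two
    neighbours u and v.  Moving u^n past v produces z^n; this unbounded gain,
    combined with recurrence, gives the key step ([heisenberg_dominated_r] and
    [heisenberg_dominated_l]): if z dominates one neighbour, then z is dominated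
    by the other.  Going round the cycle, all six rays at x generate the same
    down-set ([cycle_dominated]).  Since the rays of u at x and at x u generate
    the same down-set as well, the down-set does not depend on x either.

    This is absurd ([cycle_not_inverted]): with a = E13 and b = E31, the Weyl
    element w = a b^-1 a satisfies a w = w b^-1.  Left translation by a moves 1 up
    along the ray of a, which eventually passes w, and moves w b^m down along
    the line of b, so the event that 1 is below w b^m does not recur.

    Finally an invariant probability measure gives mass 0 to a wandering set,
    hence to a countable union of such sets. *)

(** * Heisenberg triples *)

Section heisenberg_triples.
Local Open Scope group_scope.

Definition heisenberg (G : groupType) (u v z : G) : Prop :=
  [/\ u * v = v * u * z, commute u z & commute v z].

Lemma heisenberg_expg (G : groupType) (u v z : G) n :
  heisenberg u v z -> u ^+ n * v = v * u ^+ n * z ^+ n.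
Proof.
move=> [uv uz vz]; elim: n => [|n IHn]; first by rewrite !mulg1 mul1g.
rewrite expgS -mulgA IHn !mulgA uv expgS -!mulgA; congr (v * (u * _)).
by rewrite mulgA (commuteX n (commute_sym uz)) mulgA.
Qed.

(** Inverting [u] restores the sign of the commutator after [u] and [v] are
    exchanged: moving [v ^+ n] past [u^-1] gains, rather than loses, [n] central
    steps. *)
Lemma heisenberg_invg (G : groupType) (u v z : G) :
  heisenberg u v z -> heisenberg v u^-1 z.
Proof.
move=> [uv uz vz]; split => //; last exact/commute_sym/commuteV/commute_sym.
apply: (mulgI u); rewrite !mulgA uv mulgV mul1g.
by rewrite -!mulgA (commuteV (commute_sym uz)) !mulgA mulgK.
Qed.

End heisenberg_triples.

(** * Total orders that are recurrent for left translations *)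

Section recurrent_orders.
Local Open Scope group_scope.
Context (G : groupType) (lt : rel G).
Hypothesis lt_irr : forall x, ~~ lt x x.
Hypothesis lt_trans : forall x y z, lt x y -> lt y z -> lt x z.
Hypothesis lt_total : forall x y, x != y -> lt x y (+) lt y x.
(* Recurrence: a relation between the whole ray (y s^n)_n and the point w
   returns, uniformly in n, after some positive number of translations by g. *)
Hypothesis lt_recurrent : forall g y s w,
  (forall n, lt (y * s ^+ n) w) ->
  exists m, forall n, lt (g ^+ m.+1 * (y * s ^+ n)) (g ^+ m.+1 * w).

Local Notation "x ≺ y" := (lt x y) (at level 70).
Local Notation "x ≼ y" := (~~ lt y x) (at level 70).
Implicit Types (x y z u v w s g h : G) (m n p q i j k : nat).

Let ltW x y : x ≺ y -> x ≼ y.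
Proof. by move=> xy; apply/negP => /(lt_trans xy); apply/negP. Qed.

Let lt_le_trans x y z : x ≺ y -> y ≼ z -> x ≺ z.
Proof.
move=> xy yz; have [<-//|/lt_total] := eqVneq y z.
by rewrite (negbTE yz) addbF => /(lt_trans xy).
Qed.

Let le_lt_trans x y z : x ≼ y -> y ≺ z -> x ≺ z.
Proof.
move=> xy yz; have [->//|/lt_total] := eqVneq x y.
by rewrite (negbTE xy) addbF => /lt_trans; apply.
Qed.

Definition positive u := forall x, x ≺ x * u.

(** The down-set generated by the ray [x, x u, x u^2, ...] is contained in the
    one generated by [x, x v, x v^2, ...]; down-sets of a total order are nested,
    so at a given [x] this is a total preorder on positive elements. *)
Definition dominated x u v := forall n, exists q, x * u ^+ n ≺ x * v ^+ q.

Lemma le_mul_expg u n x : positive u -> x ≼ x * u ^+ n.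
Proof.
move=> u0; elim: n => [|n IHn]; first by rewrite mulg1.
by apply/ltW/(le_lt_trans IHn); rewrite expgSr mulgA.
Qed.

Lemma le_expg u m n x : positive u -> m <= n -> x * u ^+ m ≼ x * u ^+ n.
Proof. by move=> u0 /subnKC <-; rewrite expgnDr mulgA le_mul_expg. Qed.

(** On an increasing ray weak and strict upper bounds are the same; this turns
    the negation of a strict comparison into an event to which recurrence
    applies. *)
Lemma line_below u x y : positive u ->
  (forall n, x * u ^+ n ≼ y) -> forall n, x * u ^+ n ≺ y.
Proof.
move=> u0 xy n; apply: (lt_le_trans _ (xy n.+1)).
by rewrite expgSr mulgA.
Qed.

(** Recurrence under the power [g ^+ K.+1] produces a return time of [g] which is
    at least [K]. *)
Lemma often_recurrent g y s w K : (forall n, y * s ^+ n ≺ w) ->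
  exists2 m, K <= m & forall n, g ^+ m * (y * s ^+ n) ≺ g ^+ m * w.
Proof.
move=> /(lt_recurrent (g ^+ K.+1))[m ym]; exists (K.+1 * m.+1)%N.
  by rewrite mulnS; apply: leq_trans (leqnSn K) (leq_addr _ _).
by move=> n; rewrite expgnA.
Qed.

(** Recurrence under [x u x^-1], which moves the base point [x] along its
    [u]-line: a comparison of [x h s^n] with [x y] also holds at [x u^m]. *)
Lemma recurrent_along u x h s y K : (forall n, x * h * s ^+ n ≺ x * y) ->
  exists2 m, K <= m & forall n, x * u ^+ m * h * s ^+ n ≺ x * u ^+ m * y.
Proof.
move=> /(often_recurrent (x * u * x^-1) K)[m Km xm]; exists m => // n.
have E : (x * u * x^-1) ^+ m * x = x * u ^+ m.
  elim: (m) => [|p IHp]; first by rewrite mulg1 mul1g.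
  by rewrite expgS -mulgA IHp mulgA mulgVK -mulgA -expgS.
by have := xm n; rewrite !mulgA E.
Qed.

Lemma dominated_refl x u : positive u -> dominated x u u.
Proof. by move=> u0 n; exists n.+1; rewrite expgSr mulgA. Qed.

Lemma dominated_trans v x u w :
  dominated x u v -> dominated x v w -> dominated x u w.
Proof.
move=> uv vw n; have [q xq] := uv n; have [p xp] := vw q.
by exists p; apply: lt_trans xp.
Qed.

Lemma dominated_total x u v :
  positive u -> positive v -> dominated x u v \/ dominated x v u.
Proof.
move=> u0 v0; have [|/existsNP[n /forallNP xn]] := pselect (dominated x u v).
  by left.
right=> q; exists n; apply: line_below => // p; exact/negP.
Qed.

Section heisenberg_triple.
Context (u v z : G).
Hypotheses (u0 : positive u) (v0 : positive v) (z0 : positive z).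
Hypothesis uvz : heisenberg u v z.

(** If [u] is dominated by the central element [z], some point [x u^-1 z^q] must
    lie above [x]: otherwise the whole [z]-ray at [x u^-1] lies below [x], by
    recurrence the [z]-ray at some later [x u^m] lies below [x u^(m+1)], and the
    [u]-ray escapes the [z]-ray.  Recurrence along [z] then bounds the [z]-ray at
    [x] by the one at [x u^-1], and [u^-1 v^n z^n = v^n u^-1] carries the latter
    below [x v^n]. *)
Lemma heisenberg_dominated_r x : dominated x u z -> dominated x z v.
Proof.
have [_ uz vz] := uvz.
move=> xuz n.
have [q xq] : exists q, x ≺ x * u^-1 * z ^+ q.
  apply: contrapT => /forallNP xq.
  (* the bound 1 on the return time excludes the trivial return *)
  have [|m m0 xm] := @recurrent_along u x u^-1 z 1 1.
    by rewrite mulg1; apply: line_below => // p; exact/negP.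
  case: m m0 xm => // m _ xm.
  have [p xp] := xuz m.+1.
  suff : x * z ^+ p ≺ x * z ^+ p by exact/negP.
  apply: lt_trans xp.
  apply: le_lt_trans (le_mul_expg m _ u0) _.
  have := xm p; rewrite mulg1 expgSr mulgA mulgK -!mulgA.
  by rewrite (commuteX2 m p uz).
have [|m nm xm] := @recurrent_along z x 1 1 (u^-1 * z ^+ q) n.
  by move=> ?; rewrite expg1n !mulg1 mulgA.
exists (m + q)%N.
have zu k : z ^+ k * u^-1 = u^-1 * z ^+ k.
  by apply/esym/commuteX; apply/commute_sym/commuteV/commute_sym.
apply: le_lt_trans (le_expg x z0 nm) _.
apply: lt_trans (_ : _ ≺ x * u^-1 * z ^+ (m + q)) _.
  have := xm 0; rewrite !mulg1 => /lt_le_trans; apply.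
  by rewrite mulgA -(mulgA x (z ^+ m)) zu expgnDr !mulgA lt_irr.
apply: le_lt_trans (le_mul_expg (m + q) _ v0) _.
have -> : x * u^-1 * z ^+ (m + q) * v ^+ (m + q) = x * v ^+ (m + q) * u^-1.
  rewrite -!mulgA (heisenberg_expg _ (heisenberg_invg uvz)) -mulgA.
  by rewrite (commuteX2 _ _ vz).
by have := u0 (x * v ^+ (m + q) * u^-1); rewrite mulgVK.
Qed.

(** If [v] is dominated by [z] then [x v] lies below some [x z^q], hence
    [x u^n v] below [x u^n z^q] for arbitrarily large [n]; as
    [u^n v = v u^n z^n], the point [x z^n] lies below [x u^n z^q] for these [n],
    with [q] fixed.  The surplus [z^q] is absorbed by recurrence along [z]: if
    the [u]-ray at [x] stayed below [x z^N], then for some [k >= q] the points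
    [x u^n z^k] would all stay below [x z^(k+N)]. *)
Lemma heisenberg_dominated_l x : dominated x v z -> dominated x z u.
Proof.
have [_ uz vz] := uvz.
move=> xvz N; apply: contrapT => /forallNP xN.
have [q xq] := xvz 1%N.
have [|k qk xk] := @recurrent_along z x 1 u (z ^+ N) q.
  by rewrite mulg1; apply: line_below => // n; exact/negP.
have [|n kn xn] := @recurrent_along u x v 1 (z ^+ q) (k + N).
  by move=> ?; rewrite expg1n mulg1.
suff : x * z ^+ (k + N) ≺ x * z ^+ (k + N) by exact/negP.
apply: le_lt_trans (le_expg x z0 kn) _.
apply: lt_trans (v0 _) _.
apply: le_lt_trans (le_mul_expg n _ u0) _.
have := xn 0; rewrite mulg1 -mulgA (heisenberg_expg _ uvz) => xn0.
apply: (@lt_trans _ (x * u ^+ n * z ^+ q)).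
  move: xn0; rewrite -!mulgA (commuteX2 n n uz) (mulgA v).
  by rewrite (commuteX n vz) -!mulgA.
apply: le_lt_trans (le_expg _ z0 qk) _.
have := xk n; rewrite mulg1 -!mulgA -expgnDr.
by rewrite (commuteX2 n k uz).
Qed.

End heisenberg_triple.

(** A cyclic sequence in which each element is the centre of a Heisenberg triple
    formed with its two neighbours. *)
Section cycle.
Context (a : nat -> G) (p : nat).
Hypotheses (p0 : 0 < p) (a_period : forall i, a (i + p) = a i).
Hypothesis a0 : forall i, positive (a i).
Hypothesis a_heisenberg : forall i,
  heisenberg (a i) (a i.+2) (a i.+1) \/ heisenberg (a i.+2) (a i) (a i.+1).

(** Around a triple, whichever neighbour is dominated by the centre, the centre
    is dominated by the other neighbour.  So a single dominance between adjacent
    elements propagates in its direction all the way round the cycle, which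
    forces all the dominances. *)
Lemma cycle_dominated x i j : dominated x (a i) (a j).
Proof.
have aM k i' : a (i' + k * p) = a i'.
  elim: k => [|k IHk]; first by rewrite addn0.
  by rewrite mulSn addnCA addnC a_period.
have up k : dominated x (a k) (a k.+1) -> dominated x (a k.+1) (a k.+2).
  by case: (a_heisenberg k) => H;
    [apply: heisenberg_dominated_r H _ | apply: heisenberg_dominated_l H _].
have down k : dominated x (a k.+2) (a k.+1) -> dominated x (a k.+1) (a k).
  by case: (a_heisenberg k) => H;
    [apply: heisenberg_dominated_l H _ | apply: heisenberg_dominated_r H _].
have [a01|a10] := dominated_total x (a0 0) (a0 1).
  have aS k : dominated x (a k) (a k.+1) by elim: k => // k; exact: up.
  have aD k n : dominated x (a k) (a (k + n)).
    elim: n => [|n IHn]; first by rewrite addn0; exact: dominated_refl.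
    by rewrite addnS; apply: dominated_trans IHn _.
  have ij : i <= j + i * p by rewrite (leq_trans _ (leq_addl _ _))// leq_pmulr.
  by rewrite -(aM i j) -(subnKC ij).
have aS k : dominated x (a k.+1) (a k).
  have aB n : n <= k * p ->
      dominated x (a (k * p - n).+1) (a (k * p - n)).
    elim: n => [|n IHn] nk.
      by rewrite subn0 -[(k * p)%N]add0n -addSn !aM.
    by apply: down; rewrite -subSn// subSS; apply: IHn; exact: ltnW.
  have kp : k <= k * p by rewrite leq_pmulr.
  by have := aB _ (leq_subr k (k * p)); rewrite subKn.
have aD k n : dominated x (a (k + n)) (a k).
  elim: n => [|n IHn]; first by rewrite addn0; exact: dominated_refl.
  by rewrite addnS; apply: dominated_trans (aS _) IHn.
have ji : j <= i + j * p by rewrite (leq_trans _ (leq_addl _ _))// leq_pmulr.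
by rewrite -(aM j i) -(subnKC ji).
Qed.

(** The ray of [a 0] serves as a common yardstick, since all the [a i] dominate
    each other. *)
Definition yardstick_le x y := forall n, exists q, x * a 0 ^+ n ≺ y * a 0 ^+ q.

Lemma yardstick_mulr x i : yardstick_le x (x * a i).
Proof.
move=> n; have [q xq] := cycle_dominated x 0 i n.
have [m xm] := cycle_dominated (x * a i) i 0 q.
exists m; apply: lt_trans xm; apply: lt_trans xq _.
rewrite -mulgA -expgS expgSr mulgA; exact: a0.
Qed.

Lemma yardstick_mull x i : yardstick_le (x * a i) x.
Proof.
move=> n; have [q xq] := cycle_dominated (x * a i) 0 i n.
have [m xm] := cycle_dominated x i 0 q.+1.
by exists m; apply: lt_trans xq _; rewrite -mulgA -expgS.
Qed.

Lemma yardstick_trans y x z :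
  yardstick_le x y -> yardstick_le y z -> yardstick_le x z.
Proof.
move=> xy yz n; have [q xq] := xy n; have [m ym] := yz q.
by exists m; apply: lt_trans ym.
Qed.

(** All points are interleaved with the same rays, so [1] and [w] would be too.
    But if [w] conjugates [a i] to the inverse of [a j], then left translation by
    [a i] pushes [1] up along the [a i]-ray while it pushes [w] down, namely to
    [w (a j)^-n].  Once [(a i)^n] lies above [w] and [n >= m],
    the comparison [1 ≺ w * a j ^+ m] cannot return. *)
Lemma cycle_not_inverted i j :
  let w := a i * (a j)^-1 * a i in a i * w <> w * (a j)^-1.
Proof.
move=> w aw.
have cV x : yardstick_le x (x * (a j)^-1).
  by have := @yardstick_mull (x * (a j)^-1) j; rewrite mulgVK.
have Vc x : yardstick_le (x * (a j)^-1) x.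
  by have := @yardstick_mulr (x * (a j)^-1) j; rewrite mulgVK.
have [m wm] : exists m, 1 ≺ w * a j ^+ m.
  have c1w : yardstick_le 1 w.
    apply: yardstick_trans (@yardstick_mulr _ i).
    apply: yardstick_trans (cV _).
    by have := @yardstick_mulr 1 i; rewrite mul1g.
  have [q] := c1w 0; rewrite mulg1 => q1.
  by have [m /(lt_trans q1)] := cycle_dominated w 0 j q; exists m.
have [q wq] : exists q, w ≺ a i ^+ q.
  have cw1 : yardstick_le w 1.
    apply: yardstick_trans (@yardstick_mull _ i) _.
    apply: yardstick_trans (Vc _) _.
    by have := @yardstick_mull 1 i; rewrite mul1g.
  have [n] := cw1 0; rewrite mulg1 => nw.
  by have [q /(lt_trans nw)] := cycle_dominated 1 0 i n; rewrite mul1g; exists q.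
clearbody w.
have [|n Kn wn] := @often_recurrent (a i) 1 1 (w * a j ^+ m) (maxn m q).
  by move=> ?; rewrite expg1n mulg1.
have [mn qn] : m <= n /\ q <= n by move: Kn; rewrite geq_max => /andP[].
have awn : a i ^+ n * w = w * (a j)^-1 ^+ n.
  elim: (n) => [|k IHk]; first by rewrite mulg1 mul1g.
  by rewrite expgS -mulgA IHk mulgA aw -mulgA -expgS.
suff : a i ^+ n ≺ a i ^+ n by exact/negP.
have := wn 0; rewrite !mulg1 mulgA awn => /lt_trans; apply.
apply: le_lt_trans (le_mul_expg (n - m) _ (a0 j)) _.
rewrite -!mulgA -expgnDr subnKC// expVgn mulVg mulg1.
apply: lt_le_trans wq _.
by have := le_expg 1 (a0 i) qn; rewrite !mul1g.
Qed.

End cycle.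
End recurrent_orders.

(** * Wandering sets *)

Section wandering_sets.
Context (G : groupType) d (X : measurableType d) (act : borel_action G X).

Lemma expgzD1 (g : G) (i : int) : expgz g (i + 1)%R = (expgz g i * g)%g.
Proof.
case: i => [n|[|n]].
- by rewrite -PoszD addn1 /= expgSr.
- by rewrite /= expg1 mulVg.
- have -> : (Negz n.+1 + 1)%R = Negz n by rewrite !NegzE; lia.
  by rewrite /= (expgS _ n.+1) invgM mulgVK.
Qed.

Lemma expgz_lt (g : G) (i j : int) :
  (i < j)%R -> exists m, expgz g j = (expgz g i * g ^+ m.+1)%g.
Proof.
move=> ij; have [m ->] : exists m, j = (i + Posz m.+1)%R.
  by exists `|j - i|%N.-1; lia.
exists m; elim: m => [|n IHn]; first by rewrite expgzD1 expg1.
by rewrite -[n.+2]addn1 PoszD addrA expgzD1 IHn -mulgA -expgSr addn1.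
Qed.

Definition nonreturning (g : G) (A : set X) : set X :=
  A `\` \bigcup_m act (g ^+ m.+1)%g @^-1` A.

(** Poincare's argument: if two translates [g^i B] and [g^j B] with [i < j] met,
    a point of [B] would return to [A] at time [j - i]. *)
Lemma wandering_nonreturning (g : G) (A B : set X) :
  measurable B -> B `<=` nonreturning g A -> wandering act B.
Proof.
move=> mB BA; split => //; exists g.
have disj i j p q : (i < j)%R -> B p -> B q ->
    act (expgz g i) p <> act (expgz g j) q.
  move=> /(@expgz_lt g)[m ->] /BA[Ap _] /BA[_ Aq].
  move=> /(congr1 (act (expgz g i)^-1%g)).
  rewrite -!bactM mulKg mulVg bact1 => pq.
  by apply: Aq; exists m => //=; rewrite -pq.
move=> i j _ _ [_ [[p Bp <-] [q Bq /esym pq]]].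
case: (ltgtP i j) => // ij; first by case: (disj i j p q).
by case: (disj j i q p).
Qed.

Lemma sigma_wandering_cover (I : countType) (g : I -> G) (A : I -> set X)
    (E : set X) :
  measurable E -> (forall i, measurable (A i)) ->
  E `<=` \bigcup_i nonreturning (g i) (A i) -> sigma_wandering act E.
Proof.
move=> mE mA EA.
have mN i : measurable (nonreturning (g i) (A i)).
  apply: measurableD => //; apply: bigcupT_measurable => m.
  by rewrite -[X in measurable X]setTI; exact: measurable_bact.
exists (fun n => if unpickle n is Some i then E `&` nonreturning (g i) (A i)
                 else set0); split.
  move=> n; case: (unpickle n) => [i|].
    apply: (@wandering_nonreturning (g i) (A i)) => //.
    exact: measurableI.
  by apply: (@wandering_nonreturning 1%g set0).
apply/seteqP; split => [x Ex|x [n _]].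
  have [i _ Ai] := EA _ Ex.
  by exists (pickle i) => //; rewrite pickleK.
by case: (unpickle n) => // i [].
Qed.

(** The translates [g^n A], for [n] natural, are disjoint and of equal measure
    with total at most 1. *)
Lemma wandering_null (R : realType) (mu : probability X R) (A : set X) :
  invariant_measure act mu -> wandering act A -> mu A = 0%E.
Proof.
move=> inv [mA [g tA]].
pose F n := act (g ^+ n)%g @` A.
have FE n : F n = act (g ^- n)%g @^-1` A.
  apply/seteqP; split => [_ [x Ax <-]|x Ax] /=.
    by rewrite -bactM mulVg bact1.
  by exists (act (g ^- n)%g x) => //; rewrite -bactM mulgV bact1.
have mF n : measurable (F n).
  by rewrite FE -[X in measurable X]setTI; exact: measurable_bact.
have tF : trivIset setT F.
  by move=> m n _ _ /(tA (Posz m) (Posz n) I I)[].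
have muF n : mu (F n) = mu A by rewrite FE; exact: inv.
have fA : mu A \is a fin_num by exact: fin_num_measure.
have sumA N : (fine (mu A) *+ N <= 1)%R.
  have : (mu (\bigcup_n F n) <= 1)%E.
    exact: probability_le1 (bigcupT_measurable _ mF).
  rewrite measure_semi_bigcup//; last exact: bigcupT_measurable.
  move=> /(le_trans (@nneseries_lim_ge _ _ _ 0 N _)).
  rewrite (eq_bigr (fun=> (fine (mu A))%:E)); last first.
    by move=> n _; rewrite fineK//; exact: muF.
  rewrite sumEFin lee_fin sumr_const_nat subn0; apply => n _ _.
  by rewrite measure_ge0.
apply/eqP; rewrite -(fineK fA) eqe; apply/eqP/le_anti/andP; split; last first.
  by rewrite fine_ge0.
rewrite leNgt; apply/negP => A0.
have := sumA (Num.trunc (fine (mu A))^-1).+1.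
rewrite -mulr_natr -ler_pdivlMl// mulr1 leNgt.
by rewrite truncnS_gt.
Qed.

Lemma sigma_wandering_null (R : realType) (mu : probability X R) (A : set X) :
  invariant_measure act mu -> sigma_wandering act A -> mu A = 0%E.
Proof.
move=> inv [F [wF ->]].
have mF n : measurable (F n) by case: (wF n).
apply/negligibleP; first exact: bigcupT_measurable.
apply: negligible_bigcup => n; apply/negligibleP => //.
exact: wandering_null.
Qed.

End wandering_sets.

(** * Events in the space of total orders *)

Section order_events.
Context (T : countType).

Lemma measurable_comparison (x y : T) :
  measurable [set o : Ord T | ord_rel o (x, y)].
Proof.
apply: sub_sigma_algebra.
apply: (@open_comp _ _ (fun o : Ord T => ord_rel o (x, y)) [set true]).
  2: exact: discrete_open.
move=> o _.
apply: (@continuous_comp _ _ _ (@ord_rel T) (@proj _ (fun=> bool) (x, y))).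
  exact: initial_continuous.
exact: proj_continuous.
Qed.

Lemma measurable_Ext (r : T -> T -> Prop) : measurable (Ext r).
Proof.
have -> : Ext r =
    ~` \bigcup_(p : T * T) [set o | r p.1 p.2 /\ ~ ord_rel o (p.1, p.2)].
  apply/seteqP; split => [ o oE [p _ [/oE]]//|o oE x y rxy].
  by apply: contrapT => oxy; apply: oE; exists (x, y).
apply/measurableC/countable_bigcupT_measurable => [|p]; first exact: countableP.
have [rp|nrp] := pselect (r p.1 p.2); last first.
  by rewrite (_ : mkset _ = set0)//; apply/seteqP; split => // o [].
rewrite (_ : mkset _ = ~` [set o | ord_rel o (p.1, p.2)]).
  by apply: measurableC; exact: measurable_comparison.
by apply/seteqP; split => // o [].
Qed.

End order_events.

(** * Elementary matrices of size 3 *)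

Section elementary_matrices.
Implicit Types i j k : 'I_3.

Lemma elementary_heisenberg i j k (ij : i != j) (jk : j != k) (ik : i != k) :
  heisenberg (elementary ij) (elementary jk) (elementary ik).
Proof.
have D (a b c e : 'I_3) : b != c ->
    (delta_mx a b *m delta_mx c e = 0 :> 'M[int]_3)%R.
  by move=> bc; rewrite mul_delta_mx_cond (negbTE bc) mulr0n.
split; apply: val_inj => /=.
- rewrite !(mulmxDl, mulmxDr, mulmx1, mul1mx) mul_delta_mx !D 1?eq_sym//.
  by rewrite mul0mx !addr0 -!addrA; congr (_ + _)%R; rewrite addrCA.
- rewrite !(mulmxDl, mulmxDr, mulmx1, mul1mx) !D 1?eq_sym//.
  by rewrite addr0 addr0 addrAC.
- rewrite !(mulmxDl, mulmxDr, mulmx1, mul1mx) !D 1?eq_sym//.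
  by rewrite addr0 addr0 addrAC.
Qed.

Lemma val_elementaryV i j (ij : i != j) :
  val (elementary ij)^-1%g = (1%:M - delta_mx i j)%R.
Proof.
have E : ((1%:M - delta_mx i j) *m val (elementary ij) = 1%:M)%R.
  rewrite /= mulmxDr !mulmxBl !mulmx1 mul1mx mul_delta_mx_cond.
  by rewrite eq_sym (negbTE ij) mulr0n subr0 subrK.
rewrite -[RHS]mulmx1 -{2}(mulmxV (SL3Z_unitmx (elementary ij))) mulmxA.
by rewrite E mul1mx.
Qed.

(** Both sides are the Weyl element of the copy of SL_2 attached to [i] and [j];
    consequently it conjugates [elementary ij] to the inverse of
    [elementary ji]. *)
Lemma elementary_braid i j (ij : i != j) (ji : j != i) :
  (elementary ij * (elementary ji)^-1 * elementary ij =
   (elementary ji)^-1 * elementary ij * (elementary ji)^-1)%g.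
Proof.
have D : (delta_mx i i *m delta_mx j j = 0 :> 'M[int]_3)%R.
  by rewrite mul_delta_mx_cond (negbTE ij) mulr0n.
apply: val_inj.
pose A : 'M[int]_3 := (1%:M + delta_mx i j)%R.
pose B : 'M[int]_3 := val (elementary ji)^-1%g.
change (A *m B *m A = B *m A *m B)%R.
rewrite /A /B !val_elementaryV.
rewrite !(mulmxDl, mulmxDr, mulmxBl, mulmxBr, mulmxN, mulNmx, mulmx1, mul1mx).
rewrite !mul_delta_mx.
rewrite ?mul_delta_mx_cond ?(negbTE ij) ?(negbTE ji) ?eqxx ?mulr0n ?mulr1n.
by apply/matrixP => a b; rewrite !mxE; lia.
Qed.

End elementary_matrices.

(** * The orders extending the semigroup order *)

Definition unipotent_cycle n : SL3Z := nth 1%g unipotents (n %% 6).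

(** With three indices, [E_ij] and [E_jk] are the neighbours of [E_ik] in the
    list; the sign of the commutator alternates along the cycle. *)
Lemma unipotent_cycle_heisenberg n :
  heisenberg (unipotent_cycle n) (unipotent_cycle n.+2) (unipotent_cycle n.+1) \/
  heisenberg (unipotent_cycle n.+2) (unipotent_cycle n) (unipotent_cycle n.+1).
Proof.
rewrite /unipotent_cycle -[n.+2]addn2 -[n.+1]addn1 -(modnDml n 2) -(modnDml n 1).
have : n %% 6 < 6 by rewrite ltn_mod.
case: (n %% 6) => [|[|[|[|[|[|//]]]]]] _.
- left; exact: (@elementary_heisenberg 0%R 1%R 2%R isT isT isT).
- right; exact: (@elementary_heisenberg 1%R 0%R 2%R isT isT isT).
- left; exact: (@elementary_heisenberg 1%R 2%R 0%R isT isT isT).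
- right; exact: (@elementary_heisenberg 2%R 1%R 0%R isT isT isT).
- left; exact: (@elementary_heisenberg 2%R 0%R 1%R isT isT isT).
- right; exact: (@elementary_heisenberg 0%R 2%R 1%R isT isT isT).
Qed.

(** The contrapositive of [cycle_not_inverted], whose hypotheses on the cycle
    hold because an extension makes right multiplication by a unipotent
    increasing. *)
Lemma Ext_not_recurrent (o : Ord SL3Z) : Ext sqlt o ->
  exists g y s w,
    (forall n, ord_rel o (y * s ^+ n, w)%g) /\
    (forall m, ~ forall n,
      ord_rel o (g ^+ m.+1 * (y * s ^+ n), g ^+ m.+1 * w)%g).
Proof.
move=> oE; apply: contrapT => no.
have [irr tr tot] := set_valP o.
have a0 n : positive (fun x y => ord_rel o (x, y)) (unipotent_cycle n).
  move=> x; apply: oE; exists [:: unipotent_cycle n]; split => //.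
    move=> b; rewrite inE => /eqP ->.
    by rewrite /unipotent_cycle mem_nth// ltn_mod.
  by rewrite big_seq1 mulKg.
(* the entries 1 and 4 of the cycle are E13 and E31 *)
apply: (@cycle_not_inverted _ (fun x y => ord_rel o (x, y)) irr tr tot _
  unipotent_cycle 6 isT _ a0 unipotent_cycle_heisenberg 1 4).
- move=> g y s w yw; apply: contrapT => /forallNP nr.
  by apply: no; exists g, y, s, w.
- by move=> n; rewrite /unipotent_cycle modnDr.
- have E : (unipotent_cycle 1 * (unipotent_cycle 4)^-1 * unipotent_cycle 1 =
      (unipotent_cycle 4)^-1 * unipotent_cycle 1 * (unipotent_cycle 4)^-1)%g.
    exact: (@elementary_braid 0%R 2%R isT isT).
  by rewrite [in LHS]E !mulgA.
Qed.

Theorem proposition3p9 :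
  sigma_wandering shift_action (Ext sqlt) /\
  forall R : realType,
    ~ exists mu : probability (Ord SL3Z) R,
        invariant_measure shift_action mu /\ mu (Ext sqlt) = 1%E.
Proof.
have W : sigma_wandering shift_action (Ext sqlt).
  pose I := (SL3Z * SL3Z * SL3Z * SL3Z)%type.
  (* shifting an order by g^-m compares x and y as the order compares g^m x
     and g^m y, hence the inverse *)
  apply: (@sigma_wandering_cover _ _ _ _ I (fun i => i.1.1.1^-1)%g
    (fun i => \bigcap_n [set o | ord_rel o (i.1.1.2 * i.1.2 ^+ n, i.2)%g])).
  - exact: measurable_Ext.
  - move=> i; apply: bigcap_measurableType => n _.
    exact: measurable_comparison.
  - move=> o /Ext_not_recurrent[g [y [s [w [yw nr]]]]].
    exists (g, y, s, w) => //; split => [n _|[m _ ret]]; first exact: yw.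
    apply: (nr m) => n; rewrite -[(g ^+ m.+1)%g]invgK -expVgn.
    exact: (ret n Logic.I).
split=> // R [mu [inv mu1]].
have := sigma_wandering_null inv W; rewrite mu1 => /eqP.
by rewrite onee_eq0.
Qed.
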